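(* Let $1\le p\le n$, let $G:\mathcal M_{n\times p}(\mathbb R)\to\mathbb R$ be smooth, let $U\in St^n_p$, let $\lambda\in\mathbb R$, and let $I_p=\{i_1<\dots<i_p\}\subset\{1,\dots,n\}$ be a set of row indexes such that the corresponding rows of $U$ form a full rank $p\times p$ submatrix of $U$. Let $\nu$ be a permutation of $\{1,\dots,n\}$ with $\nu(i_1)=1,\dots,\nu(i_p)=p$, and let $P\in\mathcal M_{n\times n}(\mathbb R)$ be the permutation matrix whose $i$-th row is $\mathbf e_{\nu^{-1}(i)}$. Write in block form $$PU=\begin{bmatrix} U_1 \\ {U_2} \end{bmatrix},\qquad P\,\partial G(U)=\begin{bmatrix} D_1 \\ {D_2} \end{bmatrix},$$ with $U_1,D_1\in\mathcal M_{p\times p}(\mathbb R)$ and $U_2,D_2\in\mathcal M_{(n-p)\times p}(\mathbb R)$ (so $U_1$ is invertible). Then the matrix equation $$-\lambda\,\partial G(U)=\Omega U$$ has a unique solution $\Omega\in W_{I_p}$, and it is given by $$\Omega=P^T\begin{bmatrix}\Omega_1&\Omega_2 \\ -\Omega_2^T&\mathbb O\end{bmatrix}P,\qquad \Omega_1=-\lambda\left(D_1+U_1^{-T}D_2^TU_2\right)U_1^{-1},\qquad \Omega_2=\lambda\,U_1^{-T}D_2^T.$$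
   Context: $St_p^n=\{U\in\mathcal M_{n\times p}(\mathbb R)\mid U^TU=\mathbb I_p\}$ is the orthogonal Stiefel manifold. $\nabla G(U)\in\mathcal M_{n\times p}(\mathbb R)$ is the Euclidean gradient of $G$ written as a matrix (entries are the partial derivatives of $G$ with respect to the corresponding entries of $U$). The embedded gradient is $\partial G(U)=\nabla G(U)-U\Sigma(U)$ with $\Sigma(U)=\frac12\left(\nabla G(U)^TU+U^T\nabla G(U)\right)$. $W_{I_p}$ is the space of real skew-symmetric $n\times n$ matrices $\Omega=[\omega_{ij}]$ with $\omega_{ij}=0$ whenever both $i\notin I_p$ and $j\notin I_p$. $\mathbf e_1,\dots,\mathbf e_n$ is the canonical basis of $\mathbb R^n$ (written as rows in the definition of $P$), and $U_1^{-T}=(U_1^{-1})^T$. *)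

(* Defs.v *)
From mathcomp Require Import all_boot all_order all_algebra all_fingroup.
From mathcomp Require Import boolp classical_sets reals topology normedtype derive.

Set Implicit Arguments.
Unset Strict Implicit.
Unset Printing Implicit Defensive.

Import Order.TTheory GRing.Theory Num.Theory.
Import numFieldNormedType.Exports.

Local Open Scope classical_set_scope.
Local Open Scope ring_scope.

Section Smooth.
Context {R : realType} {n p : nat}.
Implicit Types (G : 'M[R]_(n, p) -> R) (U : 'M[R]_(n, p)).

Definition partial_mx (i : 'I_n) (j : 'I_p) G : 'M[R]_(n, p) -> R :=
  fun U => 'D_(delta_mx i j) G U.

(* [class_C k G]: the iterated partial derivatives of order k exist everywhere
   and are continuous. *)
Fixpoint class_C (k : nat) G : Prop :=
  if k is k'.+1 then
    forall (i : 'I_n) (j : 'I_p),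
      (forall U, derivable G U (delta_mx i j)) /\ class_C k' (partial_mx i j G)
  else continuous G.

Definition smooth G : Prop := forall k : nat, class_C k G.

Definition gradient G U : 'M[R]_(n, p) :=
  \matrix_(i < n, j < p) partial_mx i j G U.

Definition Sigma_mx G U : 'M[R]_p :=
  2^-1 *: ((gradient G U)^T *m U + U^T *m gradient G U).

Definition embedded_gradient G U : 'M[R]_(n, p) :=
  gradient G U - U *m Sigma_mx G U.

End Smooth.

Definition stiefel (R : realType) (n p : nat) : set 'M[R]_(n, p) :=
  [set U | U^T *m U = 1%:M].

Definition skew_supported (R : realType) (n : nat) (I : {set 'I_n}) :
    set 'M[R]_n :=
  [set Om | Om^T = - Om /\
            forall i j : 'I_n, i \notin I -> j \notin I -> Om i j = 0].

Section Blocks.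
Context {R : realType} {n p : nat}.

(* The casts only rewrite p + (n - p) to n in the dimensions. *)
Definition vblock (hpn : (p <= n)%N) (A : 'M[R]_p) (B : 'M[R]_(n - p, p)) :
    'M[R]_(n, p) :=
  castmx (subnKC hpn, erefl p) (col_mx A B).

Definition sqblock (hpn : (p <= n)%N) (A : 'M[R]_p) (B : 'M[R]_(p, n - p))
    (C : 'M[R]_(n - p, p)) (D : 'M[R]_(n - p)) : 'M[R]_n :=
  castmx (subnKC hpn, subnKC hpn) (block_mx A B C D).

End Blocks.

(* Main.v *)
Require Import Defs.
From mathcomp Require Import all_boot all_order all_algebra all_fingroup.
From mathcomp Require Import boolp classical_sets reals topology normedtype derive.

Set Implicit Arguments.
Unset Strict Implicit.
Unset Printing Implicit Defensive.

Import Order.TTheory GRing.Theory Num.Theory.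
Import numFieldNormedType.Exports.

Local Open Scope ring_scope.

(* Conjugation by P identifies W_{I_p} with the matrices [A, B; -B^T, 0], A skew.
   In these coordinates the equation splits into A U1 + B U2 = - lam D1 and
   - B^T U1 = - lam D2, which determine first B and then A.  The only thing to
   check is that A is skew, i.e. that U1^T A U1 is; this is the tangency relation
   U^T D + D^T U = 0 satisfied by the embedded gradient D. *)

Lemma embedded_gradient_tangent (R : realType) (n p : nat)
    (G : 'M[R]_(n, p) -> R) (U : 'M[R]_(n, p)) :
  stiefel U ->
  U^T *m embedded_gradient G U + (embedded_gradient G U)^T *m U = 0.
Proof.
rewrite /stiefel /= => hU; rewrite /embedded_gradient /Sigma_mx.
move: (gradient G U) => g.
set X := g^T *m U + U^T *m g.
set S := 2^-1 *: X.
have ST : S^T = S by rewrite /S linearZ /= /X linearD /= !trmx_mul !trmxK addrC.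
have SD : S + S = X.
  by rewrite -mulr2n -scaler_nat scalerA divff ?pnatr_eq0// scale1r.
(* Since [U^T U = 1] and [S] is symmetric, each summand contributes [- S], so the sum is
   [X - (S + S) = 0]. *)
rewrite mulmxBr mulmxA hU mul1mx linearB /= mulmxBl trmx_mul ST.
by rewrite -mulmxA hU mulmx1 addrACA -opprD SD [_ + g^T *m U]addrC subrr.
Qed.

Lemma perm_mx_rows (R : pzSemiRingType) (n : nat) (s : {perm 'I_n}) (P : 'M[R]_n) :
  (forall k, row k P = delta_mx 0 (s k)) -> P = perm_mx s.
Proof.
move=> hP; apply/matrixP => k j.
by have /rowP/(_ j) := hP k; rewrite !mxE eqxx eq_sym.
Qed.

Section BlockSystem.
Variables (R : fieldType) (p m : nat).
Variables (U1 D1 : 'M[R]_p) (U2 D2 : 'M[R]_(m, p)) (lam : R).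
Hypothesis U1_unit : U1 \in unitmx.

Let Om1 := - lam *: (D1 + (invmx U1)^T *m D2^T *m U2) *m invmx U1.
Let Om2 := lam *: ((invmx U1)^T *m D2^T).

(** [A] is arbitrary here: the equation alone forces its value, and the skewness of that value is a
    separate matter, settled in [block_solution_skew]. *)
Lemma block_equationP (A : 'M[R]_p) (B : 'M[R]_(p, m)) :
  - lam *: col_mx D1 D2 = block_mx A B (- B^T) 0 *m col_mx U1 U2 <->
  A = Om1 /\ B = Om2.
Proof.
rewrite scale_col_mx mul_block_col mul0mx addr0 mulNmx scaleNr [- lam *: D2]scaleNr.
have eqB : B^T *m U1 = lam *: D2 <-> B = Om2.
  split=> [e|->].
    apply: (can_inj trmxK).
    by rewrite /Om2 linearZ /= trmx_mul !trmxK scalemxAl -e mulmxK.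
  by rewrite /Om2 linearZ /= trmx_mul !trmxK -scalemxAl mulmxKV.
split=> [/eq_col_mx[e1 /oppr_inj/esym/eqB eB]|[eA /[dup] eB /eqB eB']].
  split=> //; rewrite /Om1 -(mulmxK U1_unit A); congr (_ *m _).
  have -> : A *m U1 = - (lam *: D1) - B *m U2 by rewrite e1 addrK.
  by rewrite eB /Om2 -scalemxAl scaleNr scalerDr opprD.
rewrite eB' eA eB /Om1 mulmxKV // /Om2 -scalemxAl.
by rewrite scaleNr scalerDr opprD subrK.
Qed.

(** [Om1] is [- lam] times the congruence by [invmx U1] of [S = U1^T D1 + D2^T U2]. Congruence
    preserves skewness, and the hypothesis regroups as [S + S^T = 0]. *)
Lemma block_solution_skew :
  U1^T *m D1 + U2^T *m D2 + (D1^T *m U1 + D2^T *m U2) = 0 -> Om1^T = - Om1.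
Proof.
move=> tangent.
have cU1T (Y : 'M_p) : (invmx U1)^T *m (U1^T *m Y) = Y.
  by rewrite trmx_inv mulKmx // unitmx_tr.
pose S := U1^T *m D1 + D2^T *m U2.
have ST : S^T = - S.
  apply/eqP; rewrite -addr_eq0 -tangent addrC /S linearD /= !trmx_mul !trmxK.
  by rewrite [D1^T *m U1 + U2^T *m D2]addrC addrACA [D2^T *m _ + D1^T *m _]addrC.
have -> : Om1 = - lam *: ((invmx U1)^T *m S *m invmx U1).
  by rewrite /Om1 -scalemxAl /S mulmxDr cU1T mulmxA.
by rewrite linearZ /= !trmx_mul trmxK ST mulNmx mulmxN mulmxA scalerN.
Qed.

End BlockSystem.

Section SkewSupport.
Variables (R : realType) (p m : nat) (idx : 'I_p -> 'I_(p + m)) (nu : {perm 'I_(p + m)}).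
Hypothesis nu_idx : forall a, nu (idx a) = lshift m a.

Let P : 'M[R]_(p + m) := perm_mx nu^-1%g.

Lemma conj_perm_mxE (Om : 'M[R]_(p + m)) i j :
  (P *m Om *m P^T) i j = Om (nu^-1%g i) (nu^-1%g j).
Proof.
by rewrite /P tr_perm_mx invgK -row_permE -[nu in perm_mx nu]invgK -col_permE !mxE.
Qed.

(** As [nu] carries the chosen indices onto the first [p], the support condition says that the lower
    right block of the conjugate vanishes. Conjugation by a permutation matrix preserves skewness,
    which ties the lower left block to [B]. *)
Lemma skew_supportedP (Om : 'M[R]_(p + m)) :
  skew_supported [set idx a | a : 'I_p] Om <->
  exists A B, A^T = - A /\ P *m Om *m P^T = block_mx A B (- B^T) 0.
Proof.
(* [notI] and [notIP] together: the complement of the chosen indices is exactly the preimage under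
   [nu] of the last [m] indices. *)
have notI k : (nu^-1%g (rshift p k)) \notin [set idx a | a : 'I_p].
  apply/imsetP => -[a _ /(congr1 nu)]; rewrite permKV nu_idx => /eqP.
  by rewrite eq_rlshift.
have notIP i : i \notin [set idx a | a : 'I_p] -> exists k, i = nu^-1%g (rshift p k).
  move=> iI; case: (split_ordP (nu i)) => k ek; last by exists k; rewrite -ek permK.
  case/negP: iI; apply/imsetP; exists k => //.
  by apply: (@perm_inj _ nu); rewrite nu_idx.
split=> [[skew supp]|[A [B [skewA e]]]].
  set M := P *m Om *m P^T.
  have MT : M^T = - M.
    by rewrite /M !trmx_mul trmxK skew mulNmx mulmxN mulmxA.
  move: (MT); rewrite -{1 2}(submxK M) tr_block_mx opp_block_mx.
  case/eq_block_mx => skewA _ eB _.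
  exists (ulsubmx M), (ursubmx M); split => //.
  rewrite eB opprK -{1}(submxK M); congr block_mx.
  by apply/matrixP => i j; rewrite [LHS]mxE [LHS]mxE /M conj_perm_mxE supp // mxE.
have entry i j : Om (nu^-1%g i) (nu^-1%g j) = block_mx A B (- B^T) 0 i j.
  by rewrite -e conj_perm_mxE.
split=> [|i j /notIP[k ->] /notIP[l ->]]; last first.
  by rewrite entry block_mxEdr mxE.
(* Writing each index as [nu^-1 (nu i)] turns entries of [Om] into entries of the block matrix,
   whose skewness is visible. *)
apply/matrixP => i j; rewrite !mxE -(permK nu i) -(permK nu j) !entry.
have : (block_mx A B (- B^T) 0)^T = - block_mx A B (- B^T) 0.
  by rewrite tr_block_mx opp_block_mx skewA trmx0 linearN /= trmxK opprK oppr0.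
by move/matrixP/(_ (nu i) (nu j)); rewrite [LHS]mxE [RHS]mxE.
Qed.

End SkewSupport.

(** The dimension is literally [p + m], so the blocks need no casts, and the embedded gradient is
    replaced by any [D] satisfying the tangency relation. As [P] is orthogonal, the whole problem
    transfers to the block system. *)
Lemma skew_supported_solution (R : realType) (p m : nat)
    (U D : 'M[R]_(p + m, p)) (lam : R) (idx : 'I_p -> 'I_(p + m))
    (nu : {perm 'I_(p + m)}) (U1 D1 : 'M[R]_p) (U2 D2 : 'M[R]_(m, p)) :
  U^T *m D + D^T *m U = 0 ->
  \rank (rowsub idx U) = p ->
  (forall a, nu (idx a) = lshift m a) ->
  perm_mx nu^-1%g *m U = col_mx U1 U2 ->
  perm_mx nu^-1%g *m D = col_mx D1 D2 ->
  let Om1 := - lam *: (D1 + (invmx U1)^T *m D2^T *m U2) *m invmx U1 in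
  let Om2 := lam *: ((invmx U1)^T *m D2^T) in
  U1 \in unitmx /\
  forall Om : 'M[R]_(p + m),
    (skew_supported [set idx a | a : 'I_p] Om /\ - lam *: D = Om *m U) <->
    Om = (perm_mx nu^-1%g)^T *m block_mx Om1 Om2 (- Om2^T) 0 *m perm_mx nu^-1%g.
Proof.
set P : 'M[R]_(p + m) := perm_mx _ => tangent rankU nu_idx hPU hPD Om1 Om2.
have PPT : P *m P^T = 1%:M by rewrite /P tr_perm_mx -perm_mxM mulgV perm_mx1.
have PTP : P^T *m P = 1%:M by rewrite /P tr_perm_mx -perm_mxM mulVg perm_mx1.
have U1_unit : U1 \in unitmx.
  rewrite -row_free_unit /row_free -[X in _ == X]rankU.
  suff -> : U1 = rowsub idx U by [].
  (* Row [a] of [P U] is row [nu^-1 a = idx a] of [U], so [U1] is the selected full rank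
     submatrix. *)
  apply/matrixP => a b; rewrite -(col_mxEu U1 U2) -hPU -row_permE !mxE.
  by rewrite -nu_idx permK.
split=> // Om.
have tangent1 : U1^T *m D1 + U2^T *m D2 + (D1^T *m U1 + D2^T *m U2) = 0.
  have dotP (X Y : 'M_(p + m, p)) : (P *m X)^T *m (P *m Y) = X^T *m Y.
    by rewrite trmx_mul -mulmxA (mulmxA P^T) PTP mul1mx.
  by rewrite -tangent -(dotP U D) -(dotP D U) hPU hPD !tr_col_mx !mul_row_col.
have conjP M : Om = P^T *m M *m P <-> P *m Om *m P^T = M.
  split=> [->|<-]; first by rewrite !mulmxA PPT mul1mx -mulmxA PPT mulmx1.
  by rewrite !mulmxA PTP mul1mx -mulmxA PTP mulmx1.
have eqnP : - lam *: D = Om *m U <->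
    - lam *: col_mx D1 D2 = P *m Om *m P^T *m col_mx U1 U2.
  rewrite -hPU -hPD -(mulmxA _ P^T) (mulmxA P^T) PTP mul1mx -mulmxA scalemxAr.
  split=> [->//|/(congr1 (mulmx P^T))].
  by rewrite !(mulmxA P^T) PTP !mul1mx.
rewrite conjP eqnP (skew_supportedP nu_idx).
split=> [[[A [B [_ e]]]]|e].
  by rewrite e => /(block_equationP _ _ _ _ U1_unit)[-> ->].
rewrite e; split; last exact/(block_equationP _ _ _ _ U1_unit).
by exists Om1, Om2; split=> //; apply: block_solution_skew.
Qed.

Theorem mainTheorem12 (R : realType) (n p : nat)
    (hp : (1 <= p)%N) (hpn : (p <= n)%N)
    (G : 'M[R]_(n, p) -> R) (hG : smooth G)
    (U : 'M[R]_(n, p)) (hU : stiefel U)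
    (lam : R)
    (idx : 'I_p -> 'I_n)
    (hidx : forall a b : 'I_p, (a < b)%N -> (idx a < idx b)%N)
    (I : {set 'I_n}) (hI : I = [set idx a | a : 'I_p])
    (hrank : \rank (rowsub idx U) = p)
    (nu : {perm 'I_n})
    (hnu : forall a : 'I_p, nu (idx a) = a :> nat)
    (P : 'M[R]_n)
    (hP : forall k : 'I_n, row k P = delta_mx 0 ((nu^-1)%g k))
    (U1 D1 : 'M[R]_p) (U2 D2 : 'M[R]_(n - p, p))
    (hPU : P *m U = vblock hpn U1 U2)
    (hPD : P *m embedded_gradient G U = vblock hpn D1 D2) :
  let W := skew_supported I in
  let Om1 := - lam *: (D1 + (invmx U1)^T *m D2^T *m U2) *m invmx U1 in
  let Om2 := lam *: ((invmx U1)^T *m D2^T) in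
  U1 \in unitmx /\
  (exists! Om : 'M[R]_n,
      W Om /\ - lam *: embedded_gradient G U = Om *m U) /\
  (forall Om : 'M[R]_n,
      W Om -> - lam *: embedded_gradient G U = Om *m U ->
      Om = P^T *m sqblock hpn Om1 Om2 (- Om2^T) 0 *m P).
Proof.
move=> W Om1 Om2.
(* This one equivalence yields existence, uniqueness and the formula. *)
have [U1_unit sol] : U1 \in unitmx /\ forall Om : 'M[R]_n,
    (W Om /\ - lam *: embedded_gradient G U = Om *m U) <->
    Om = P^T *m sqblock hpn Om1 Om2 (- Om2^T) 0 *m P.
  have := embedded_gradient_tangent G hU.
  move: (perm_mx_rows hP) hPU hPD; rewrite /W hI /sqblock /vblock => -> {P hP}.
  move: (embedded_gradient G U) => D.
  clear hG G hI I hidx hU W.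
  rewrite /Om1 /Om2 {Om1 Om2}.
  (* With [n - p] generalized to [m], eliminating [e : p + m = n] replaces [n] by [p + m] and makes
     the casts trivial. *)
  move: (subnKC hpn) => e; move: U1 D1 U2 D2.
  move: (n - p)%N e => m e; case: n / e idx nu U D hrank hnu hpn.
  move=> idx nu U D rankU hnu _ U1 D1 U2 D2; rewrite !castmx_id => hU hD tangent.
  by apply: skew_supported_solution => // a; apply: val_inj; rewrite /= hnu.
split=> //; split=> [|Om WOm eOm]; last exact/sol.
exists (P^T *m sqblock hpn Om1 Om2 (- Om2^T) 0 *m P).
by split=> [|Om /sol]; first exact/sol.
Qed.
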